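(* For each positive integer $n$, let $a(n)$ be the number of $6 \times 2n$ matrices with entries in $\{0,1\}$ such that every row contains exactly $n$ ones and every column contains exactly $3$ ones. Then for all positive integers $n$, \begin{align*} & 51200 (2n+7)(2n+5)(2n+3)(2n+1)(n+2)(n+1)\bigl(33n^2+242n+445\bigr)\, a(n) \\ & - 128 (2n+7)(2n+5)(2n+3)(n+2)\bigl(7491n^4+84898n^3+351364n^2+628997n+414370\bigr)\, a(n+1) \\ & + 16 (2n+5)(2n+7)\bigl(2772n^6+48048n^5+344379n^4+1307394n^3+2775099n^2+3125336n+1460132\bigr)\, a(n+2) \\ & + 2(2n+7)(n+3)\bigl(3201n^6+61886n^5+497179n^4+2124170n^3+5089654n^2+6484024n+3431096\bigr)\, a(n+3) \\ & - (n+3)(n+4)^5\bigl(33n^2+176n+236\bigr)\, a(n+4) = 0. \end{align*} *)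

(* Defs.v *)
From mathcomp Require Import all_boot matrix.

Set Implicit Arguments.
Unset Strict Implicit.
Unset Printing Implicit Defensive.

(* Entries are booleans, summed through the coercion of bool into nat. *)
Definition a (n : nat) : nat :=
  #|[set M : 'M[bool]_(6, 2 * n) |
      [forall i, \sum_(j < 2 * n) M i j == n] &&
      [forall j, \sum_(i < 6) M i j == 3]]|.

(* Main.v *)
(* Record the row sums r_i of a 6 x N matrix all of whose columns have three
   ones by the deviations d_i = 2 r_i - N, and let nmx N d be the number of such
   matrices.  It is invariant under permutations of d (permuting the rows) and
   under d |-> -d (exchanging zeros and ones).  Counting the ones of row i gives
     (N + d_i) nmx N d = 2 N \sum_c nmx (N - 1) (d - c),
   where c runs over the +-1 columns with a one in row i, and comparing this
   identity for two rows of the same d gives linear relations between the counts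
   for N - 1 columns.  With coefficients rational in N, these relations reduce
   every deviation met below to four orbits e1, e2, e3, e4.  Hence the vector of
   the nmx (2 m) e_k satisfies a first order 4 x 4 linear recurrence in m, and
   since a m = nmx (2 m) e1, the claimed recurrence becomes an identity between
   rational functions. *)

Require Import Defs.
From Stdlib Require Import ZArith.
From mathcomp Require Import all_boot.
From Stdlib Require Import Lia.
From HB Require Import structures.
From mathcomp Require Import matrix ssrZ.

Set Implicit Arguments.
Unset Strict Implicit.
Unset Printing Implicit Defensive.

Local Open Scope Z_scope.

HB.instance Definition _ :=
  Monoid.isComLaw.Build Z 0 Z.add Z.add_assoc Z.add_comm Z.add_0_l.
HB.instance Definition _ :=
  Monoid.isMulLaw.Build Z 0 Z.mul Z.mul_0_l Z.mul_0_r.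
HB.instance Definition _ :=
  Monoid.isAddLaw.Build Z Z.mul Z.add Z.mul_add_distr_r Z.mul_add_distr_l.

Local Notation "\Sum_ ( i <- r ) F" := (\big[Z.add/0]_(i <- r) F)
  (at level 36, F at level 36, i, r at level 50).
Local Notation "\Sum_ ( i <- r | P ) F" := (\big[Z.add/0]_(i <- r | P) F)
  (at level 36, F at level 36, i, r at level 50).

Local Arguments Z.add : simpl never.
Local Arguments Z.sub : simpl never.
Local Arguments Z.mul : simpl never.
Local Arguments Z.pow : simpl never.

(** * Counting by deviations, and marking a one in a row *)

Definition columns : seq bitseq :=
  permutations [:: true; true; true; false; false; false].

Definition sgn (b : bool) : Z := if b then 1 else -1.

(** Deleting column [c] turns [2 * r_i - N] into [2 * (r_i - c_i) - (N - 1)], which is lower by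
    [2 * c_i - 1 = sgn c_i]. *)
Definition shift (d : seq Z) (c : bitseq) : seq Z :=
  [seq p.1 - sgn p.2 | p <- zip d c].

Fixpoint nmx (N : nat) (d : seq Z) : Z :=
  if N is N'.+1 then \Sum_(c <- columns) nmx N' (shift d c)
  else if all (pred1 0) d then 1 else 0.

Lemma nmxS N d : nmx N.+1 d = \Sum_(c <- columns) nmx N (shift d c).
Proof. by []. Qed.

Lemma size_column c : c \in columns -> size c = 6%N.
Proof. by rewrite mem_permutations => /perm_size. Qed.

Lemma size_shift d c : size d = 6%N -> c \in columns -> size (shift d c) = 6%N.
Proof. by move=> sd /size_column sc; rewrite size_map size_zip sd sc. Qed.

Lemma nth_shift d c i : size d = 6%N -> c \in columns -> (i < 6)%N ->
  nth 0 (shift d c) i = nth 0 d i - sgn (nth false c i).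
Proof.
move=> sd /size_column sc i6.
by rewrite (nth_map (0, false)) ?size_zip ?sd ?sc // nth_zip ?sd ?sc.
Qed.

Lemma shiftC d c c' : size d = 6%N -> c \in columns -> c' \in columns ->
  shift (shift d c) c' = shift (shift d c') c.
Proof.
move=> sd cc cc'; apply: (@eq_from_nth _ 0); rewrite !size_shift ?size_shift //.
by move=> i i6; rewrite !nth_shift ?size_shift //; ring.
Qed.

Lemma nmx_mark N d i : size d = 6%N -> (i < 6)%N ->
  (Z.of_nat N.+1 + nth 0 d i) * nmx N.+1 d =
  2 * Z.of_nat N.+1 * \Sum_(c <- columns | nth false c i) nmx N (shift d c).
Proof.
(* By induction: the marked one lies in the first column or in a later one. *)
move=> + i6.
(* Since [1 + sgn b] is 2 or 0, the second sum accounts for a mark in the first column and the first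
   sum for a mark further on. *)
have split_mark (x : Z) (f : bitseq -> Z) :
    (x + 1) * \Sum_(c <- columns) f c =
    \Sum_(c <- columns) ((x - sgn (nth false c i)) * f c)
    + 2 * \Sum_(c <- columns | nth false c i) f c.
  rewrite [in X in _ = _ + X]big_mkcond !big_distrr -big_split /=.
  apply: eq_bigr => c _; case: (nth _ c i) => /=; ring.
elim: N d => [|N IHN] d sd.
  have -> : Z.of_nat 1 + nth 0 d i = nth 0 d i + 1 by rewrite Z.add_comm.
  (* With no column left, a nonzero count forces [shift d c] to vanish, and then the factor in front
     is its entry 0. *)
  rewrite nmxS split_mark big_seq big1 => [|c cc]; first by ring.
  rewrite -nth_shift //=; case: allP => [d0|_]; last by rewrite Z.mul_0_r.
  by rewrite (eqP (d0 _ (mem_nth _ _))) ?size_shift.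
rewrite nmxS.
have -> : Z.of_nat N.+2 + nth 0 d i = (Z.of_nat N.+1 + nth 0 d i) + 1 by lia.
rewrite split_mark.
have -> : \Sum_(c <- columns)
    ((Z.of_nat N.+1 + nth 0 d i - sgn (nth false c i)) * nmx N.+1 (shift d c)) =
  2 * Z.of_nat N.+1 * \Sum_(c <- columns | nth false c i) nmx N.+1 (shift d c).
  (* The induction hypothesis marks a later column [c']; exchanging [c] and [c'] makes the marked
     column the first one. *)
  under [in RHS]eq_bigr do rewrite nmxS.
  rewrite exchange_big /= big_distrr /= big_seq [RHS]big_seq.
  apply: eq_bigr => c cc.
  rewrite -Z.add_sub_assoc -nth_shift // IHN ?size_shift //; congr (_ * _).
  rewrite big_seq_cond [RHS]big_seq_cond; apply: eq_bigr => c' /andP[cc' _].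
  by rewrite shiftC.
by rewrite [Z.of_nat N.+2]Nat2Z.inj_succ; ring.
Qed.

(** * Invariance under negation and permutation of the rows *)

Lemma nmx_opp N d : size d = 6%N -> nmx N [seq - x | x <- d] = nmx N d.
Proof.
elim: N d => [|N IHN] d sd.
  by rewrite /= all_map (@eq_all _ _ (pred1 0)) // => -[].
rewrite !nmxS.
have negP : perm_eq columns [seq map negb c | c <- columns] by vm_compute.
rewrite (perm_big _ negP) big_map big_seq [RHS]big_seq; apply: eq_bigr => c cc.
rewrite -[RHS]IHN ?size_shift //; congr (nmx N _).
elim: d c {sd cc} => [|x d IHd] [|b c] //=; rewrite -IHd; congr (_ :: _).
by case: b => /=; ring.
Qed.

Definition reorder (T : Type) (x0 : T) (s : seq nat) (d : seq T) : seq T :=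
  [seq nth x0 d i | i <- s].

(** Reordering the rows maps [columns] injectively into itself, hence only permutes the terms of the
    sum over the first column. *)
Lemma nmx_reorder N d s : size d = 6%N -> perm_eq s (iota 0 6) ->
  nmx N (reorder 0 s d) = nmx N d.
Proof.
move=> + s6.
have ss : size s = 6%N by rewrite (perm_size s6) size_iota.
have ltn6 i : i \in s -> (i < 6)%N by rewrite (perm_mem s6) mem_iota.
have perm_reorder (T : eqType) (x0 : T) t : size t = 6%N ->
    perm_eq (reorder x0 s t) t.
  by move=> st; rewrite -{2}(mkseq_nth x0 t) st /mkseq perm_map.
have inj_reorder (T : eqType) (x0 : T) (t t' : seq T) :
    size t = 6%N -> size t' = 6%N -> reorder x0 s t = reorder x0 s t' -> t = t'.
  move=> st st' /eq_in_map e; apply: (@eq_from_nth _ x0); rewrite ?st ?st' //.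
  by move=> i i6; apply: e; rewrite (perm_mem s6) mem_iota.
elim: N d => [|N IHN] d sd.
  by rewrite /= (perm_all _ (perm_reorder _ 0 _ sd)).
rewrite !nmxS.
have reorderP : perm_eq columns [seq reorder false s c | c <- columns].
  have u : uniq [seq reorder false s c | c <- columns].
    rewrite map_inj_in_uniq ?permutations_uniq // => c c' /size_column sc.
    by move=> /size_column sc'; apply: inj_reorder.
  have sub : {subset [seq reorder false s c | c <- columns] <= columns}.
    move=> _ /mapP[c cc ->]; move: (cc); rewrite !mem_permutations.
    by apply: perm_trans; apply: perm_reorder (size_column cc).
  have [|_ e] := uniq_min_size u sub; first by rewrite size_map.
  by apply: uniq_perm => // [|c]; rewrite ?permutations_uniq // e.
rewrite (perm_big _ reorderP) big_map big_seq [RHS]big_seq.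
apply: eq_bigr => c cc.
rewrite -[RHS]IHN ?size_shift //; congr (nmx N _).
rewrite /shift /reorder zip_map -map_comp.
by apply/eq_in_map => i /ltn6 i6 /=; rewrite nth_shift.
Qed.

Lemma nmx_perm N d d' : size d' = 6%N -> perm_eq d d' -> nmx N d = nmx N d'.
Proof.
by move=> sd' /(perm_iotaP 0)[s]; rewrite sd' => s6 ->; apply: nmx_reorder.
Qed.

(** * Orbit representatives and linear relations checked by computation *)

Definition canon (d : seq Z) : seq Z :=
  let s := sort Z.geb d in
  let t := sort Z.geb [seq - x | x <- d] in
  if foldr (fun p b => (p.2 <? p.1) || (p.1 =? p.2) && b) true (zip s t)
  then s else t.

Lemma nmx_canon N d : size d = 6%N -> nmx N (canon d) = nmx N d.
Proof.
move=> sd; rewrite /canon; case: ifP => _; last rewrite -(nmx_opp N sd).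
  by apply: nmx_perm => //; rewrite perm_sort.
by apply: nmx_perm; rewrite ?size_map // perm_sort.
Qed.

(** A boolean certificate, checked by evaluation: [l] lists, with multiplicities and up to orbits,
    what remains of [d] after deleting a column with a one in row [i]. *)
Definition expands (d : seq Z) (i : nat) (l : seq (nat * seq Z)) : bool :=
  [&& size d == 6%N, (i < 6)%N, all (fun p => size p.2 == 6%N) l &
    perm_eq (flatten [seq nseq p.1 (canon p.2) | p <- l])
      [seq canon (shift d c) | c <- columns & nth false c i]].

Definition combine (N : nat) (l : seq (nat * seq Z)) : Z :=
  foldr (fun p x => Z.of_nat p.1 * nmx N p.2 + x) 0 l.

(** The separate [w] lets the coefficients appear as polynomials in whatever form the number of
    columns is given, such as [2 * z + 1]. *)
Lemma nmx_expand N w d i l : w = Z.of_nat N.+1 -> expands d i l ->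
  (w + nth 0 d i) * nmx N.+1 d = 2 * w * combine N l.
Proof.
move=> ->; case/and4P=> /eqP sd i6 /allP sl /(perm_big _) e.
rewrite nmx_mark //; congr (_ * _).
have -> : \Sum_(c <- columns | nth false c i) nmx N (shift d c) =
    \Sum_(d' <- [seq canon (shift d c) | c <- columns & nth false c i])
      nmx N d'.
  rewrite big_map big_filter big_seq_cond [RHS]big_seq_cond.
  by apply: eq_bigr => c /andP[cc _]; rewrite nmx_canon // size_shift.
rewrite -e big_flatten big_map /=; elim: l sl {e} => [|[k d'] l IHl] sl.
  by rewrite big_nil.
rewrite big_cons IHl => [|p pl]; last by apply: sl; rewrite in_cons pl orbT.
congr (_ + _); have /eqP sd' := sl _ (mem_head _ _); rewrite /= in sd' *.
elim: k {sl} => [|k IHk]; first by rewrite big_nil.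
rewrite Nat2Z.inj_succ /= big_cons IHk nmx_canon //. ring.
Qed.

Lemma scale_eq (c l r : Z) : l = r -> c * l = c * r.
Proof. by move->. Qed.

Lemma add_eq (l r l' r' : Z) : l = r -> l' = r' -> l + l' = r + r'.
Proof. by move=> -> ->. Qed.

(** Supports elimination by certificate: [l = r] is a combination of known equations, built with
    [*!] and [+!], and [k] clears the common factor. What remains is a polynomial identity for
    [ring]. *)
Lemma lincomb (k L R l r : Z) :
  k <> 0 -> l = r -> k * (L - R) = l - r -> L = R.
Proof.
by move=> k0 ->; rewrite Z.sub_diag => /Z.mul_eq_0[/k0|/Z.sub_move_0_r].
Qed.

Local Notation "c *! h" := (scale_eq c h) (at level 40, only parsing).
Local Notation "h +! h'" := (add_eq h h')
  (at level 50, left associativity, only parsing).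

(** Cross-multiplying the expansions along rows [i] and [j] cancels [nmx N.+1 d]; the common factor
    [2 * w] is positive. *)
Lemma nmx_balance N w d i j l l' :
  w = Z.of_nat N.+1 -> expands d i l -> expands d j l' ->
  (w + nth 0 d j) * combine N l = (w + nth 0 d i) * combine N l'.
Proof.
move=> wE /(nmx_expand wE) e /(nmx_expand wE) e'.
apply: (lincomb (k := 2 * w) _
  (- (w + nth 0 d j) *! e +! (w + nth 0 d i) *! e')).
  by lia.
by ring.
Qed.

(** * The orbits that occur and the relations between them *)

Definition e1 : seq Z := [:: 0; 0; 0; 0; 0; 0].
Definition e2 : seq Z := [:: 2; 0; 0; 0; 0; -2].
Definition e3 : seq Z := [:: 2; 2; 0; 0; -2; -2].
Definition e4 : seq Z := [:: 4; 0; 0; 0; 0; -4].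
(** The [x] are the even orbits to be rewritten in the [e]. The [o] and [y] serve odd [N]: a nonzero
    count requires the entries to have the parity of [N]. *)
Definition x0 : seq Z := [:: 2; 2; 2; -2; -2; -2].
Definition x1 : seq Z := [:: 4; 0; 0; 0; -2; -2].
Definition x2 : seq Z := [:: 4; 2; 0; -2; -2; -2].
Definition x3 : seq Z := [:: 4; 2; 0; 0; -2; -4].
Definition o1 : seq Z := [:: 1; 1; 1; -1; -1; -1].
Definition o2 : seq Z := [:: 3; 1; -1; -1; -1; -1].
Definition o3 : seq Z := [:: 3; 3; -1; -1; -1; -3].
Definition y1 : seq Z := [:: 3; 1; 1; -1; -1; -3].
Definition y2 : seq Z := [:: 5; 1; -1; -1; -1; -3].

Lemma nmx_x0 N w : w = Z.of_nat N.+1 ->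
  (w + 1) * nmx N x0 =
  (w - 1) * nmx N e1 + (3 * w - 9) * nmx N e2 - (3 * w + 9) * nmx N e3.
Proof.
move=> wE.
have /= b := nmx_balance (d := o1) (i := 0) (j := 3)
  (l := [:: (1, e1); (6, e2); (3, e3)]%N)
  (l' := [:: (3, e2); (6, e3); (1, x0)]%N) wE isT isT.
by apply: (lincomb (k := 1) _ (-1 *! b)) => //; ring.
Qed.

Lemma nmx_x1 N w : w = Z.of_nat N.+1 ->
  3 * (w + 3) * nmx N x1 = 3 * (w + 1) * nmx N e3 - 4 * nmx N e2.
Proof.
move=> wE.
have /= b := nmx_balance (d := o2) (i := 0) (j := 1)
  (l := [:: (4, e2); (6, e3)]%N) (l' := [:: (4, e2); (6, x1)]%N) wE isT isT.
by apply: (lincomb (k := 2) _ (-1 *! b)) => //; ring.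
Qed.

Lemma nmx_x2 N w : w = Z.of_nat N.+1 ->
  (w + 3) * nmx N x2 = (w - 1) * nmx N e2 - 6 * nmx N e3.
Proof.
move=> wE.
have /= b := nmx_balance (d := o2) (i := 0) (j := 2)
  (l := [:: (4, e2); (6, e3)]%N)
  (l' := [:: (1, e2); (3, e3); (3, x1); (3, x2)]%N) wE isT isT.
by apply: (lincomb (k := 3) _ (-1 *! b +! -1 *! nmx_x1 wE)) => //; ring.
Qed.

Lemma nmx_x3 N w : w = Z.of_nat N.+1 ->
  6 * (w + 3) ^ 2 * nmx N x3 =
  3 * (w - 1) * (w + 3) * nmx N e1 + 4 * (3 * w ^ 2 - 2 * w - 17) * nmx N e2
  - 6 * (w ^ 2 + 14 * w + 17) * nmx N e3 - 3 * (w + 3) ^ 2 * nmx N e4.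
Proof.
move=> wE.
have /= b := nmx_balance (d := y1) (i := 0) (j := 1)
  (l := [:: (1, e2); (4, e3); (2, x1); (1, x0); (2, x2)]%N)
  (l' := [:: (1, e2); (2, e3); (3, x1); (1, e4); (1, x2); (2, x3)]%N)
  wE isT isT.
(* The balance for [y1] contains [e4 + 2 * x3] on one side; the other three relations remove [x0],
   [x1] and [x2]. *)
apply: (lincomb (k := 1) _ (-3 * (w + 3) *! b +! 3 * (w + 3) *! nmx_x0 wE
  +! - (w + 7) *! nmx_x1 wE +! 3 * (w - 1) *! nmx_x2 wE)) => //.
by ring.
Qed.

Lemma nmx_y1 N w : w = Z.of_nat N.+1 ->
  3 * (w + 2) * nmx N y1 = 3 * (w - 2) * nmx N o1 - 8 * nmx N o2.
Proof.
move=> wE.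
have /= b := nmx_balance (d := e2) (i := 0) (j := 1)
  (l := [:: (6, o1); (4, o2)]%N)
  (l' := [:: (3, o1); (4, o2); (3, y1)]%N) wE isT isT.
by apply: (lincomb (k := 1) _ (-1 *! b)) => //; ring.
Qed.

(** The marked row 0 carries the largest deviation, so the factor [w + d_0] on the left is positive
    and few orbits arise. *)
Lemma nmx_odd_step N w : w = Z.of_nat N.+1 ->
  [/\ (w + 1) * nmx N.+1 o1 = 2 * w * (nmx N e1 + 6 * nmx N e2 + 3 * nmx N e3),
      (w + 3) * nmx N.+1 o2 = 2 * w * (4 * nmx N e2 + 6 * nmx N e3),
      (w + 3) * nmx N.+1 o3 =
        2 * w * (3 * nmx N e3 + nmx N x1 + 3 * nmx N x2 + 3 * nmx N x3) &
      (w + 5) * nmx N.+1 y2 =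
        2 * w * (nmx N e4 + 3 * nmx N x1 + 3 * nmx N x2 + 3 * nmx N x3)].
Proof.
move=> wE; split.
- have /= -> := nmx_expand (d := o1) (i := 0)
    (l := [:: (1, e1); (6, e2); (3, e3)]%N) wE isT.
  by ring.
- have /= -> := nmx_expand (d := o2) (i := 0)
    (l := [:: (4, e2); (6, e3)]%N) wE isT.
  by ring.
- have /= -> := nmx_expand (d := o3) (i := 0)
    (l := [:: (3, e3); (1, x1); (3, x2); (3, x3)]%N) wE isT.
  by ring.
have /= -> := nmx_expand (d := y2) (i := 0)
  (l := [:: (1, e4); (3, x1); (3, x2); (3, x3)]%N) wE isT.
by ring.
Qed.

Lemma nmx_even_step N w : w = Z.of_nat N.+1 ->
  [/\ w * nmx N.+1 e1 = 2 * w * (10 * nmx N o1),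
      (w + 2) * nmx N.+1 e2 = 2 * w * (6 * nmx N o1 + 4 * nmx N o2),
      (w + 2) * nmx N.+1 e3 =
        2 * w * (2 * nmx N o1 + 3 * nmx N o2 + 4 * nmx N y1 + nmx N o3) &
      (w + 4) * nmx N.+1 e4 = 2 * w * (6 * nmx N y1 + 4 * nmx N y2)].
Proof.
move=> wE; split.
- have /= := nmx_expand (d := e1) (i := 0) (l := [:: (10, o1)]%N) wE isT.
  by rewrite Z.add_0_r => ->; ring.
- have /= -> := nmx_expand (d := e2) (i := 0)
    (l := [:: (6, o1); (4, o2)]%N) wE isT.
  by ring.
- have /= -> := nmx_expand (d := e3) (i := 0)
    (l := [:: (2, o1); (3, o2); (4, y1); (1, o3)]%N) wE isT.
  by ring.
have /= -> := nmx_expand (d := e4) (i := 0)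
  (l := [:: (6, y1); (4, y2)]%N) wE isT.
by ring.
Qed.

(** * The first order recurrence obtained by adding two columns *)

Local Notation E d m := (nmx (2 * m) d).

Lemma E_step m z : z = Z.of_nat m ->
  [/\ (z + 1) * E e1 m.+1 =
        20 * (2 * z + 1) * (E e1 m + 6 * E e2 m + 3 * E e3 m),
      (z + 2) ^ 2 * E e2 m.+1 =
        4 * (2 * z + 1) * (3 * (z + 2) * E e1 m + 2 * (13 * z + 22) * E e2 m
          + 3 * (7 * z + 10) * E e3 m),
      (z + 2) ^ 4 * E e3 m.+1 =
        (2 * z + 1) * ((z + 2) * (15 * z ^ 2 + 35 * z + 16) * E e1 m
          + 2 * (57 * z ^ 3 + 225 * z ^ 2 + 272 * z + 92) * E e2 m
          + 2 * (37 * z ^ 3 + 125 * z ^ 2 + 122 * z + 28) * E e3 m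
          - 3 * (z + 1) * (z + 2) ^ 2 * E e4 m) &
      (z + 2) * (z + 3) ^ 2 * E e4 m.+1 =
        4 * (2 * z + 1) * (6 * z * (z + 2) * E e1 m
          + 36 * (z ^ 2 + z - 1) * E e2 m + 9 * (z ^ 2 - 5 * z - 8) * E e3 m
          - (z + 1) * (z + 2) * E e4 m)].
Proof.
move=> zE; rewrite (_ : 2 * m.+1 = (2 * m).+2)%N; last by lia.
have z0 : 0 <= z by lia.
have oddE : 2 * z + 1 = Z.of_nat (2 * m).+1 by lia.
have evenE : 2 * z + 2 = Z.of_nat (2 * m).+2 by lia.
have [h1 h2 h3 h4] := nmx_odd_step oddE.
have [g1 g2 g3 g4] := nmx_even_step evenE.
(* Each relation concerns one column fewer than its [w]: [y1] is removed at [2 * m + 1] columns, and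
   [x1], [x2], [x3] at [2 * m]. *)
have [f f1 f2 f3] :=
  And4 (nmx_y1 evenE) (nmx_x1 oddE) (nmx_x2 oddE) (nmx_x3 oddE).
move: (2 * m)%N h1 h2 h3 h4 g1 g2 g3 g4 f f1 f2 f3 => N.
move=> h1 h2 h3 h4 g1 g2 g3 g4 f f1 f2 f3; split.
- by apply: (lincomb (k := 2) _ (1 *! g1 +! 20 *! h1)) => //; ring.
- apply: (lincomb (k := 2) _
    ((z + 2) *! g2 +! 12 * (z + 2) *! h1 +! 8 * (z + 1) *! h2)) => //.
  by ring.
- apply: (lincomb (k := 12) _ (6 * (z + 2) ^ 3 *! g3
    +! 16 * (z + 1) * (z + 2) ^ 2 *! f
    +! 12 * (2 * (z + 2) ^ 3 + 4 * z * (z + 2) ^ 2) *! h1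
    +! (36 * (z + 1) * (z + 2) ^ 2 - 64 * (z + 1) * (z + 2)) *! h2
    +! 12 * (z + 1) * (z + 2) ^ 2 *! h3
    +! 4 * (z + 1) * (z + 2) * (2 * z + 1) *! f1
    +! 36 * (z + 1) * (z + 2) * (2 * z + 1) *! f2
    +! 3 * (z + 1) * (2 * z + 1) *! f3)) => //.
  by ring.
apply: (lincomb (k := 2 * (z + 2)) _ ((z + 2) ^ 2 * (z + 3) *! g4
  +! 4 * (z + 1) * (z + 2) * (z + 3) *! f
  +! 12 * z * (z + 2) * (z + 3) *! h1
  +! -16 * (z + 1) * (z + 3) *! h2
  +! 8 * (z + 1) * (z + 2) ^ 2 *! h4
  +! 8 * (z + 1) * (z + 2) * (2 * z + 1) *! f1
  +! 24 * (z + 1) * (z + 2) * (2 * z + 1) *! f2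
  +! 2 * (z + 1) * (2 * z + 1) *! f3)); first by lia.
by ring.
Qed.

(** * From matrices to the recursive count *)

Definition column_seq (c : 'cV[bool]_6) : bitseq := [seq c i ord0 | i : 'I_6].

Lemma nth_column_seq c (i : 'I_6) : nth false (column_seq c) i = c i ord0.
Proof.
by rewrite (nth_map i) ?size_enum_ord // nth_ord_enum.
Qed.

Lemma mem_columns b :
  (b \in columns) = (size b == 6%N) && (count id b == 3%N).
Proof.
rewrite mem_permutations; apply/idP/andP => [p|[/eqP sb /eqP cb]].
  by rewrite (perm_size p) (permP p).
apply/permP => q.
(* For booleans, the length and the number of [true] determine a list up to permutation. *)
have countE s :
    count q s = (q true * count id s + q false * (size s - count id s))%N.
  elim: s => [|x s IHs]; first by rewrite !muln0.
  case: x; rewrite /= IHs; first by rewrite add1n mulnS subSS addnA.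
  by rewrite add0n subSn ?count_size // mulnS addnCA.
by rewrite !countE sb cb.
Qed.

Lemma column_seqP c :
  (column_seq c \in columns) = (\sum_(i < 6) c i ord0 == 3)%N.
Proof.
rewrite mem_columns size_map size_enum_ord /= -sum1_count big_map big_mkcond.
by rewrite big_enum; congr (_ == _); apply: eq_bigr => i _; case: (c i ord0).
Qed.

(** Bridges sums over column vectors and sums over the computable list [columns]. *)
Lemma big_columns (F : bitseq -> Z) :
  \big[Z.add/0]_(c : 'cV[bool]_6 | column_seq c \in columns) F (column_seq c) =
  \Sum_(b <- columns) F b.
Proof.
have p : perm_eq columns
    [seq column_seq c | c <- index_enum 'cV[bool]_6 & column_seq c \in columns].
  apply: uniq_perm => [||b]; first exact: permutations_uniq.
    rewrite map_inj_uniq ?filter_uniq ?index_enum_uniq // => c c' e.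
    by apply/matrixP => i j; rewrite ord1 -!nth_column_seq e.
  apply/idP/mapP => [cb|[c + ->]]; last by rewrite mem_filter => /andP[].
  have cE : column_seq (\col_i nth false b i)%R = b.
    apply: (@eq_from_nth _ false); rewrite size_map size_enum_ord.
      by rewrite (size_column cb).
    by move=> i i6; rewrite (nth_column_seq _ (Ordinal i6)) mxE.
  exists (\col_i nth false b i)%R; last by rewrite cE.
  by rewrite mem_filter cE cb mem_index_enum.
by rewrite (perm_big _ p) big_map big_filter.
Qed.

Definition margins N (d : seq Z) (M : 'M[bool]_(6, N)) : bool :=
  [forall i : 'I_6,
    2 * Z.of_nat (\sum_(j < N) M i j)%N == Z.of_nat N + nth 0 d i] &&
  [forall j, (\sum_(i < 6) M i j)%N == 3%N].

Lemma margins_row_mx N d c (M : 'M[bool]_(6, N)) : size d = 6%N ->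
  @margins (1 + N) d (row_mx c M) =
  (column_seq c \in columns) && margins (shift d (column_seq c)) M.
Proof.
move=> sd; rewrite /margins.
have -> : [forall j, (\sum_(i < 6) row_mx c M i j)%N == 3%N] =
    (column_seq c \in columns) && [forall j, (\sum_(i < 6) M i j)%N == 3%N].
  rewrite column_seqP; apply/forallP/andP => [H|[Hc /forallP HM] j].
    split; last apply/forallP => j.
      by have := H (lshift N ord0); under eq_bigr do rewrite row_mxEl.
    by have := H (rshift 1 j); under eq_bigr do rewrite row_mxEr.
  case: (split_ordP j) => k ->.
    by rewrite ord1; under eq_bigr do rewrite row_mxEl.
  by under eq_bigr do rewrite row_mxEr.
rewrite andbCA; case cc: (_ \in columns) => //=; congr (_ && _).
apply: eq_forallb => i; rewrite big_split_ord big_ord1 /= row_mxEl.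
under eq_bigr do rewrite row_mxEr.
rewrite nth_shift // nth_column_seq Nat2Z.inj_add.
by apply/eqP/eqP; case: (c i ord0) => /=; lia.
Qed.

Lemma card_margins N d : size d = 6%N ->
  Z.of_nat #|[set M : 'M[bool]_(6, N) | margins d M]| = nmx N d.
Proof.
elim: N d => [|N IHN] d sd.
  (* Empty rows sum to 0, so the unique matrix without columns has zero deviations. *)
  have marginsE (M : 'M[bool]_(6, 0)) : margins d M = all (pred1 0) d.
    rewrite /margins [X in _ && X](_ : _ = true) ?andbT; last first.
      by apply/forallP; case.
    apply/forallP/(all_nthP 0) => H i.
      rewrite sd => i6; have := H (Ordinal i6).
      by rewrite big_ord0 Z.mul_0_r eq_sym.
    by rewrite big_ord0 Z.mul_0_r eq_sym; apply: H; rewrite sd.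
  have -> : [set M : 'M[bool]_(6, 0) | margins d M] =
      if all (pred1 0) d then setT else set0.
    by apply/setP => M; rewrite inE marginsE; case: ifP; rewrite inE.
  by rewrite /=; case: ifP; rewrite ?cards0 // cardsT card_mx muln0.
rewrite nmxS -big_columns -sum1dep_card.
rewrite (reindex (fun p : 'cV[bool]_6 * 'M[bool]_(6, N) =>
  row_mx p.1 p.2 : 'M_(6, 1 + N))) /=; last first.
  exists (fun M : 'M_(6, 1 + N) => (lsubmx M, rsubmx M)) => [[c M] _|M _] /=.
    by rewrite row_mxKl row_mxKr.
  by rewrite hsubmxK.
rewrite (eq_bigl _ _ (fun p => margins_row_mx p.1 p.2 sd)).
rewrite -(pair_big_dep (fun c => column_seq c \in columns)
  (fun c M => margins (shift d (column_seq c)) M) (fun _ _ => 1%N)) /=.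
rewrite (big_morph Z.of_nat Nat2Z.inj_add (erefl (Z.of_nat 0))).
apply: eq_bigr => c cc.
by rewrite -IHN ?size_shift // sum1dep_card.
Qed.

Lemma a_nmx n : Z.of_nat (a n) = nmx (2 * n) e1.
Proof.
rewrite -card_margins // /a; congr Z.of_nat; apply: eq_card => M.
rewrite !inE; congr (_ && _); apply: eq_forallb => i.
have -> : nth 0 e1 i = 0 by case: i => [] [|[|[|[|[|[|]]]]]].
by apply/eqP/eqP; lia.
Qed.

Theorem theorem5 (n : nat) (n_gt0 : (0 < n)%N) :
  let z := Z.of_nat n in
  let A (k : nat) := Z.of_nat (a k) in
  51200 * (2 * z + 7) * (2 * z + 5) * (2 * z + 3) * (2 * z + 1)
    * (z + 2) * (z + 1) * (33 * z ^ 2 + 242 * z + 445) * A n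
  - 128 * (2 * z + 7) * (2 * z + 5) * (2 * z + 3) * (z + 2)
    * (7491 * z ^ 4 + 84898 * z ^ 3 + 351364 * z ^ 2 + 628997 * z + 414370)
    * A (n + 1)%N
  + 16 * (2 * z + 5) * (2 * z + 7)
    * (2772 * z ^ 6 + 48048 * z ^ 5 + 344379 * z ^ 4 + 1307394 * z ^ 3
       + 2775099 * z ^ 2 + 3125336 * z + 1460132)
    * A (n + 2)%N
  + 2 * (2 * z + 7) * (z + 3)
    * (3201 * z ^ 6 + 61886 * z ^ 5 + 497179 * z ^ 4 + 2124170 * z ^ 3
       + 5089654 * z ^ 2 + 6484024 * z + 3431096)
    * A (n + 3)%N
  - (z + 3) * (z + 4) ^ 5 * (33 * z ^ 2 + 176 * z + 236) * A (n + 4)%N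
  = 0.
Proof.
move=> z A; rewrite /A !a_nmx addn1 addn2 addn3 addn4.
have z0 : 0 <= z by lia.
have zE : z = Z.of_nat n by [].
have zE1 : z + 1 = Z.of_nat n.+1 by lia.
have zE2 : z + 2 = Z.of_nat n.+2 by lia.
have zE3 : z + 3 = Z.of_nat n.+3 by lia.
(* Going down from [n + 4], [e1] calls for [e1], [e2], [e3] at [n + 3], and these for all four
   orbits at [n + 2]. The hypotheses [zE1] to [zE3] keep every coefficient a polynomial in [z]. *)
have [h1 h2 h3 h4] := E_step zE.
have [g1 g2 g3 g4] := E_step zE1.
have [f1 f2 f3 _] := E_step zE2.
have [k1 _ _ _] := E_step zE3.
clearbody z; clear A zE zE1 zE2 zE3.
(* The multipliers come from eliminating the counts for n + 4, n + 3, n + 2 and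
   n + 1 in turn; after each elimination the remaining linear form happens to
   have polynomial coefficients, so only the last step needs the factor z + 2. *)
pose q := 33 * z ^ 2 + 176 * z + 236.
(* This is [q] at [z + 1]; [s] and [q] are the quadratic factors in the coefficients of [a n] and
   [a (n + 4)]. *)
pose s := 33 * z ^ 2 + 242 * z + 445.
pose t := (2 * z + 5) * (2 * z + 7).
apply: (lincomb (k := z + 2) _
  (- (z + 2) * (z + 3) * (z + 4) ^ 4 * q *! k1
  +! 2 * (z + 2) * (z + 3) * (2 * z + 7)
    * (2871 * z ^ 5 + 46233 * z ^ 4 + 296280 * z ^ 3 + 944130 * z ^ 2
       + 1495664 * z + 942312) *! f1
  +! -120 * (z + 2) * (z + 3) * (z + 4) ^ 2 * (2 * z + 7) * q *! f2
  +! -60 * (z + 2) * (z + 3) * (2 * z + 7) * q *! f3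
  +! 4 * (z + 2) * t
    * (20493 * z ^ 5 + 319506 * z ^ 4 + 1983369 * z ^ 3 + 6130428 * z ^ 2
       + 9440540 * z + 5797744) *! g1
  +! 120 * (z + 2) * t
    * (429 * z ^ 4 + 4004 * z ^ 3 + 11208 * z ^ 2 + 5168 * z - 11824) *! g2
  +! -240 * (z + 2) * t * (561 * z ^ 2 + 4048 * z + 7356) *! g3
  +! 180 * (z + 2) * (z + 3) * t * q *! g4
  +! -128 * (z + 2) ^ 2 * (2 * z + 3) * t
    * (4521 * z ^ 3 + 42922 * z ^ 2 + 132597 * z + 131720) *! h1
  +! 1920 * (2 * z + 3) * t
    * (363 * z ^ 4 + 4510 * z ^ 3 + 20823 * z ^ 2 + 42344 * z + 32040) *! h2
  +! -15360 * (2 * z + 3) * t * s *! h3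
  +! 11520 * (z + 2) * (2 * z + 3) * t * s *! h4)); first by lia.
by rewrite /q /s /t; ring.
Qed.
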